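(* Let $(X,\mu)$ be a measure space and let $J,Q\subseteq(0,\infty)$ be nonempty with $m_J=\inf J>0$ and $m_Q=\inf Q>0$, and let $M_J=\sup J\in(0,\infty]$. Then $$IL_{J,Q}(X,\mu)=L_{m_J,m_Q}(X,\mu)\cap L_{M_J,m_Q}(X,\mu).$$ Moreover, there is a constant $K>0$ such that for each $f\in IL_{J,Q}(X,\mu)$, $$\max\{\|f\|_{L_{m_J,m_Q}},\|f\|_{L_{M_J,m_Q}}\}\leq\sup_{p\in J,\,q\in Q}\|f\|_{L_{p,q}}\leq K\max\{\|f\|_{L_{m_J,m_Q}},\|f\|_{L_{M_J,m_Q}}\}.$$
   Context: For a complex-valued measurable function $f$ on a measure space $(X,\mu)$, let $d_f(\alpha)=\mu(\{x\in X:|f(x)|>\alpha\})$ for $\alpha>0$, and let $f^*:[0,\infty)\to[0,\infty]$, $f^*(t)=\inf\{s>0:d_f(s)\leq t\}$ (with $\inf\emptyset=\infty$) be the decreasing rearrangement. For $0<p\leq\infty$ and $0<q<\infty$ put $\|f\|_{L_{p,q}}=\left(\int_0^\infty (t^{1/p}f^*(t))^q\frac{dt}{t}\right)^{1/q}$, and for $q=\infty$ put $\|f\|_{L_{p,\infty}}=\sup_{t>0}t^{1/p}f^*(t)$, with $1/\infty=0$. The Lorentz space $L_{p,q}(X,\mu)$ is the set of all $f$ with $\|f\|_{L_{p,q}}<\infty$, functions equal $\mu$-almost everywhere being identified. In particular $L_{\infty,q}(X,\mu)=\{0\}$ for $0<q<\infty$. For nonempty $J,Q\subseteq(0,\infty)$,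 $$IL_{J,Q}(X,\mu)=\Big\{f\in\bigcap_{p\in J,\,q\in Q}L_{p,q}(X,\mu):\ \|f\|_{L_{J,Q}}=\sup_{p\in J,\,q\in Q}\|f\|_{L_{p,q}}<\infty\Big\}.$$ *)

(* Defs.v *)
From HB Require Import structures.
From mathcomp Require Import all_boot all_order all_algebra.
From mathcomp Require Import complex.
From mathcomp Require Import all_classical all_reals all_analysis.
From mathcomp Require Import lra.

Set Implicit Arguments.
Unset Strict Implicit.
Unset Printing Implicit Defensive.

Import Order.TTheory GRing.Theory Num.Theory.
Import numFieldNormedType.Exports.
Import ComplexField.Normc.

Local Open Scope classical_set_scope.
Local Open Scope ring_scope.

(* R[i] with the Borel sigma-algebra of its norm topology. *)
Definition borelC (R : realType) :=
  g_sigma_algebraType (@open (R[i] : numFieldType)).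

Local Open Scope ereal_scope.

Section lorentz.
Context d (X : measurableType d) (R : realType).
Variable mu : {measure set X -> \bar R}.

Definition distribution_fun (f : X -> R[i]) (a : R) : \bar R :=
  mu [set x | (a < normc (f x))%R].

Definition rearrangement (f : X -> R[i]) (t : R) : \bar R :=
  ereal_inf [set s%:E | s in [set s | (0 < s)%R /\
                                      distribution_fun f s <= t%:E]].

(* [p^-1] is the inverse of \bar R, so that [+oo^-1 = 0];
   the branch [q = -oo] is junk. *)
Definition lorentz_norm (p q : \bar R) (f : X -> R[i]) : \bar R :=
  match q with
  | r%:E => (\int[lebesgue_measure]_(t in `]0%R, +oo[)
              (((t `^ fine p^-1)%R%:E * rearrangement f t) `^ r * (t^-1)%:E))
            `^ r^-1
  | +oo => ereal_sup [set (t `^ fine p^-1)%R%:E * rearrangement f t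
                     | t in `]0%R, +oo[]
  | -oo => 0
  end.

(* Spaces are sets of classes of measurable functions modulo equality
   mu-a.e.; a class coerces to a representative, on which the value of
   [lorentz_norm] does not depend, see
   [eq_ae_lorentz_norm] and [lorentz_norm_pi]. *)
Definition lorentz_space (p q : \bar R) : set {mfun_ mu, X >-> borelC R} :=
  [set f | lorentz_norm p q f < +oo].

Definition il_norm (J Q : set R) (f : X -> R[i]) : \bar R :=
  ereal_sup [set lorentz_norm p%:E q%:E f | p in J & q in Q].

Definition il_space (J Q : set R) : set {mfun_ mu, X >-> borelC R} :=
  (\bigcap_(p in J) \bigcap_(q in Q) lorentz_space p%:E q%:E) `&`
  [set f | il_norm J Q f < +oo].

End lorentz.
Arguments lorentz_space {d X R} mu p q.
Arguments il_space {d X R} mu J Q.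

Lemma measurable_normc_gt (R : realType) (a : R) :
  measurable ([set z | (a < normc z)%R] : set (borelC R)).
Proof.
apply: sub_sigma_algebra; rewrite openE => z /= az.
apply/nbhs_ballP; exists (normc z - a)%:C%C => /=.
  by rewrite ltcR subr_gt0.
move=> w; rewrite -ball_normE /= => zw.
have {}zw : (normc (z - w) < normc z - a)%R by rewrite -ltcR.
have := le_normcD (z - w)%R w; rewrite subrK.
lra.
Qed.

Section lorentz_ae.
Context d (X : measurableType d) (R : realType).
Variables (mu : {measure set X -> \bar R}) (f g : {mfun X >-> borelC R}).
Hypothesis fg : f = g %[ae mu].

Lemma eq_ae_distribution_fun : distribution_fun mu f = distribution_fun mu g.
Proof.
apply/funext => a; rewrite /distribution_fun.
have m (h : {mfun X >-> borelC R}) : measurable [set x | (a < normc (h x))%R].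
  have := measurable_funP h measurableT _ (measurable_normc_gt a).
  by rewrite setTI.
have sub (h k : {mfun X >-> borelC R}) : h = k %[ae mu] ->
    mu [set x | (a < normc (h x))%R] <= mu [set x | (a < normc (k x))%R].
  move=> [N [mN N0 hkN]].
  rewrite -(measureU0 (m k) mN N0); apply: le_measure; rewrite ?inE //.
    exact: measurableU.
  move=> x /= ax; have [Nx|Nx] := pselect (N x); [by right|left].
  suff <- : h x = k x by [].
  by apply: contrapT => hk; apply/Nx/hkN => /= /(_ I).
by apply/eqP; rewrite eq_le !sub //; exact: ae_eq_sym.
Qed.

Lemma eq_ae_lorentz_norm p q : lorentz_norm mu p q f = lorentz_norm mu p q g.
Proof. by rewrite /lorentz_norm /rearrangement eq_ae_distribution_fun. Qed.

End lorentz_ae.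

Lemma lorentz_norm_pi d (X : measurableType d) (R : realType)
    (mu : {measure set X -> \bar R}) (p q : \bar R)
    (f : {mfun X >-> borelC R}) :
  lorentz_norm mu p q ((\pi f)%qT : {mfun_ mu, X >-> borelC R}) =
  lorentz_norm mu p q f.
Proof.
apply: eq_ae_lorentz_norm.
have := reprK ((\pi f)%qT : {mfun_ mu, X >-> borelC R}).
by move/eqmodP => /asboolP.
Qed.

(* Main.v *)
(** Write alpha = 1/p, with 1/oo = 0, so that the L_{p,q} norm is the q-th root
    of the integral of (t^alpha f*(t))^q dt/t.

    Upper bound: for 1/M_J <= alpha <= 1/m_J the weight t^alpha is at most
    t^(1/m_J) + t^(1/M_J), which controls the exponent m_Q. Since f* decreases,
    integrating over [t/2, t] bounds t^alpha f*(t) pointwise by the norm with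
    exponent m_Q, and this absorbs the excess power q - m_Q; all constants stay
    bounded because alpha <= 1/m_J and q >= m_Q.

    Lower bound: apply Fatou's lemma along p_n -> m_J (or M_J) and q_n -> m_Q.
    As 1/p_n -> 1/M_J = 0 when M_J = oo, that case needs no separate treatment:
    the bound then says that the L_{oo,m_Q} norm is finite, i.e. f = 0. *)
Require Import Defs.
From mathcomp Require Import all_boot all_order all_algebra.
From mathcomp Require Import complex.
From mathcomp Require Import all_classical all_reals all_analysis.
From mathcomp Require Import measurable_realfun ring lra.

Set Implicit Arguments.
Unset Strict Implicit.
Unset Printing Implicit Defensive.

Import Order.TTheory GRing.Theory Num.Theory.
Import numFieldNormedType.Exports.

Local Open Scope classical_set_scope.
Local Open Scope ring_scope.
Local Open Scope ereal_scope.

(** * Powers and lower limits of extended reals; measurability of monotone functions *)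

Lemma poweRV_le (R : realType) (x y : \bar R) (q : R) :
  (0 < q)%R -> 0 <= x -> 0 <= y -> (x `^ q^-1 <= y) = (x <= y `^ q).
Proof.
move=> q0 x0 y0.
have nn (z : \bar R) : 0 <= z -> z \in `[0, +oo].
  by move=> z0; rewrite in_itv/= z0 leey.
have qV0 : (0 <= q^-1)%R by rewrite invr_ge0 ltW.
apply/idP/idP => h.
  have := gt0_ler_poweR (ltW q0) (nn _ (poweR_ge0 _ _)) (nn _ y0) h.
  by rewrite -poweRrM mulVf ?gt_eqF// poweRe1.
have := gt0_ler_poweR qV0 (nn _ x0) (nn _ (poweR_ge0 _ _)) h.
by rewrite -[(y `^ q) `^ _]poweRrM mulfV ?gt_eqF// poweRe1.
Qed.

Lemma le_poweR (R : realType) (x y : \bar R) (q : R) :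
  (0 <= q)%R -> 0 <= x -> x <= y -> x `^ q <= y `^ q.
Proof.
move=> q0 x0 xy; apply: gt0_ler_poweR => //; rewrite in_itv/= ?leey ?andbT//.
exact: le_trans xy.
Qed.

Lemma limn_einf_le (R : realType) (u v : (\bar R)^nat) :
  (forall n, u n <= v n) -> limn_einf u <= limn_einf v.
Proof.
move=> uv; rewrite !limn_einf_lim; apply: lee_lim.
- exact: is_cvg_einfs.
- exact: is_cvg_einfs.
- apply: nearW => n; apply: le_ereal_inf_tmp => _ [k /= nk <-].
  by apply: le_trans (uv k); apply: ereal_inf_lbound; exists k.
Qed.

(** For real [x] other than 0 the power is exp(q ln x), continuous in q. At 0 and at the infinite
    values it is constant over nonzero exponents but jumps at exponent 0, hence the positivity
    assumptions. *)
Lemma cvg_poweR_exponent (R : realType) (x : \bar R) (q_ : R^nat) (q : R) :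
  (0 < q)%R -> (forall n, 0 < q_ n)%R -> q_ @ \oo --> q ->
  x `^ (q_ n) @[n --> \oo] --> x `^ q.
Proof.
move=> q0 q_0 qq; case: x => [x| |].
- have [->|x0] := eqVneq x 0%R.
    rewrite poweR0r ?gt_eqF//.
    under eq_fun do rewrite poweR0r ?gt_eqF//.
    exact: cvg_cst.
  rewrite poweR_EFin; under eq_fun do rewrite poweR_EFin.
  apply: cvg_EFin; first exact: nearW.
  rewrite /comp /powR (negbTE x0).
  apply: continuous_cvg; first exact: continuous_expR.
  exact: cvgMl.
- rewrite poweRyr ?gt_eqF//.
  under eq_fun do rewrite poweRyr ?gt_eqF//.
  exact: cvg_cst.
- rewrite poweRNyr ?gt_eqF//.
  under eq_fun do rewrite poweRNyr ?gt_eqF//.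
  exact: cvg_cst.
Qed.

(** The preimage of each ray [r, +oo] is downward closed, hence an interval. *)
Lemma nonincreasing_emeasurable (R : realType) (D : set R) (g : R -> \bar R) :
  measurable D -> {homo g : s t / (s <= t)%R >-> t <= s} -> measurable_fun D g.
Proof.
move=> mD gni.
apply: (measurability (@ErealGenCInfty.G R)) => [|/= _ [_] [r] -> <-].
  exact: ErealGenCInfty.measurableE.
apply: measurableI => //; apply: is_interval_measurable => s t/=.
rewrite !in_itv/= !andbT => gs gt u /andP[su ut].
by rewrite in_itv/= andbT (le_trans gt)// gni.
Qed.

(** * Weighted integrals of a nonincreasing function on the half-line *)

Section weighted_integral.
Context {R : realType}.
Implicit Types (a q r s t : R) (g : R -> \bar R).

(** Here [a] plays the role of 1/p and [g] that of f*, so that p = oo is the ordinary value a =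
    0. *)
Definition weighted_power a q g t : \bar R :=
  ((t `^ a)%:E * g t) `^ q * (t^-1)%:E.

Definition weighted_integral a q g : \bar R :=
  \int[lebesgue_measure]_(t in `]0%R, +oo[) weighted_power a q g t.

Variable g : R -> \bar R.
Hypotheses (g0 : forall t, 0 <= g t)
  (gni : {homo g : s t / (s <= t)%R >-> t <= s}).

Lemma weighted_power_ge0 a q t : (0 < t)%R -> 0 <= weighted_power a q g t.
Proof.
by move=> t0; rewrite mule_ge0 ?poweR_ge0// lee_fin invr_ge0 ltW.
Qed.

Lemma weighted_integral_ge0 a q : 0 <= weighted_integral a q g.
Proof.
apply: integral_ge0 => t /=; rewrite in_itv/= andbT.
exact: weighted_power_ge0.
Qed.

Lemma measurable_weighted_power a q :
  measurable_fun (`]0%R, +oo[ : set R) (weighted_power a q g).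
Proof.
apply: emeasurable_funM.
  apply: (@measurableT_comp _ _ _ _ _ _ (fun x : \bar R => x `^ q)).
    exact: measurable_poweR.
  apply: emeasurable_funM; last exact: nonincreasing_emeasurable.
  apply/measurable_EFinP; apply: measurable_funTS; exact: measurable_powR.
apply/measurable_EFinP.
apply: (eq_measurable_fun (fun t : R => t `^ (-1)))%R.
  move=> t; rewrite inE/= in_itv/= andbT => t0.
  by rewrite powR_inv1// ltW.
apply: measurable_funTS; exact: measurable_powR.
Qed.

(* On [t/2, t] the integrand is at least
   ((t/2)^a g(t))^q / t = 2^-(a q) (t^a g(t))^q / t. *)
Lemma weighted_integral_pointwise a q t :
  (0 <= a)%R -> (0 < q)%R -> (0 < t)%R ->
  ((t `^ a)%:E * g t) `^ q <=
    (2 `^ (a * q + 1))%R%:E * weighted_integral a q g.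
Proof.
move=> a0 q0 t0.
pose c := (((t / 2) `^ a)%R%:E * g t) `^ q * (t^-1)%:E.
have h0 : (0 < t / 2)%R by rewrite divr_gt0.
have sub : `[(t / 2)%R, t]%classic `<=` `]0%R, +oo[%classic.
  move=> s /=; rewrite !in_itv/= andbT => /andP[hs _].
  exact: lt_le_trans hs.
have : \int[lebesgue_measure]_(s in `[(t / 2)%R, t]) (cst c s) <=
    weighted_integral a q g.
  apply: (le_trans (y := \int[lebesgue_measure]_(s in `[(t / 2)%R, t])
      weighted_power a q g s)).
    apply: ge0_le_integral => //.
    - by move=> s _; rewrite mule_ge0 ?poweR_ge0// lee_fin invr_ge0 ltW.
    - apply: measurable_funS (measurable_weighted_power a q) => //.
    - move=> s; rewrite /= in_itv/= => /andP[hs st].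
      have s0 : (0 < s)%R by exact: lt_le_trans hs.
      apply: lee_pmul; rewrite ?poweR_ge0 ?lee_fin ?invr_ge0 ?(ltW t0)//.
        apply: le_poweR; rewrite ?(ltW q0) ?mule_ge0 ?lee_fin ?powR_ge0//.
        apply: lee_pmul => //; rewrite ?lee_fin ?powR_ge0 ?gni//.
        by apply: ge0_ler_powR; rewrite ?nnegrE// ltW.
      by rewrite lef_pV2 ?posrE.
  apply: ge0_subset_integral => //.
    exact: measurable_weighted_power.
  by move=> s /=; rewrite in_itv/= andbT; exact: weighted_power_ge0.
rewrite integral_cst//= lebesgue_measure_itv/= lte_fin.
have -> : (t / 2 < t)%R by lra.
rewrite -EFinD => cI.
(* The interval has length t/2, so [c * (t - t / 2)] loses a factor 2 besides 2^(a q); this is the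
   [+ 1] in the exponent. *)
apply: (@le_trans _ _ ((2 `^ (a * q + 1))%:E * (c * (t - t / 2)%:E))).
  rewrite /c !poweRM ?lee_fin ?powR_ge0// !poweR_EFin.
  rewrite -!muleA -!EFinM [_ `^ q * _%:E]muleC !muleA -!EFinM.
  rewrite lee_wpmul2r ?poweR_ge0//.
  rewrite lee_fin powRM ?invr_ge0// ?(ltW t0)//.
  rewrite powRD; last by rewrite pnatr_eq0 implybT.
  rewrite powRr1// powRrM.
  have E : ((2 `^ a) `^ q * (2^-1 `^ a) `^ q = 1)%R.
    by rewrite -!powRM ?powR_ge0// mulfV// !powR1.
  have Et : (t^-1 * (t - t / 2) = 2^-1)%R by field; rewrite gt_eqF.
  rewrite powRM ?powR_ge0// Et.
  have alg (u v w : R) : (u * 2 * (w * v) * 2^-1 = u * v * w)%R by field.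
  by rewrite alg E mul1r.
by rewrite lee_pmul2l// ?lte_fin ?powR_gt0.
Qed.

(** Splitting at t = 1: t^a is at most t^a2 for t >= 1 and at most t^a1 for t <= 1. *)
Lemma weighted_integral_le_add a a1 a2 q : (0 < q)%R ->
  (a1 <= a <= a2)%R ->
  weighted_integral a q g <= weighted_integral a1 q g + weighted_integral a2 q g.
Proof.
move=> q0 /andP[a1a aa2].
have pos b t : `]0%R, +oo[%classic t -> 0 <= weighted_power b q g t.
  by rewrite /= in_itv/= andbT; exact: weighted_power_ge0.
rewrite -ge0_integralD//; [|exact: pos|exact: measurable_weighted_power
  |exact: pos|exact: measurable_weighted_power].
apply: ge0_le_integral => //; [exact: pos|exact: measurable_weighted_power| |].
  by apply: emeasurable_funD; exact: measurable_weighted_power.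
move=> t /= tpos; have := tpos; rewrite in_itv/= andbT => t0.
have mon b : (t `^ a <= t `^ b)%R ->
    weighted_power a q g t <= weighted_power b q g t.
  move=> ab; rewrite lee_wpmul2r ?lee_fin ?invr_ge0 ?(ltW t0)//.
  apply: le_poweR; rewrite ?(ltW q0) ?mule_ge0 ?lee_fin ?powR_ge0//.
  by rewrite lee_wpmul2r.
have [t1|/ltW t1] := leP 1%R t.
  by apply: (le_trans (mon a2 _)); [exact: ler_powR|rewrite leeDr// pos].
apply: (le_trans (mon a1 _)); last by rewrite leeDl// pos.
by apply: ger_powR; rewrite ?t0.
Qed.

(** Write (t^a g)^q as (t^a g)^(q - r) (t^a g)^r and bound the first factor by M^(q - r). *)
Lemma weighted_integral_bounded a q r (M : R) : (0 < r <= q)%R -> (0 <= M)%R ->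
  (forall t, (0 < t)%R -> (t `^ a)%:E * g t <= M%:E) ->
  weighted_integral a q g <= (M `^ (q - r))%:E * weighted_integral a r g.
Proof.
move=> /andP[r0 rq] M0 gM.
have pos b s t : `]0%R, +oo[%classic t -> 0 <= weighted_power b s g t.
  by rewrite /= in_itv/= andbT; exact: weighted_power_ge0.
rewrite -ge0_integralZl ?lee_fin ?powR_ge0//;
  [|exact: measurable_weighted_power|exact: pos].
apply: ge0_le_integral => //; [exact: pos|exact: measurable_weighted_power| |].
  by apply: measurable_funeM; exact: measurable_weighted_power.
move=> t /=; rewrite in_itv/= andbT => t0.
rewrite muleA lee_wpmul2r ?lee_fin ?invr_ge0 ?(ltW t0)//.
have x0 : 0 <= (t `^ a)%:E * g t by rewrite mule_ge0 ?lee_fin ?powR_ge0.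
rewrite -{1}(subrK r q) poweRD; last first.
  by apply: add_neq0_poweRD_def; rewrite subrK gt_eqF// (lt_le_trans r0).
rewrite -(poweR_EFin M) lee_wpmul2r ?poweR_ge0// le_poweR ?subr_ge0//.
exact: gM.
Qed.
(* With M the bound of t^a g(t) obtained from the exponent r, the exponent q
   costs M^(q - r); the constant does not depend on q, and it depends on a
   only through the upper bound a2. *)
Lemma weighted_integral_root_le a a1 a2 q r (N : \bar R) :
  (0 <= a1)%R -> (a1 <= a <= a2)%R -> (0 < r <= q)%R -> 0 <= N ->
  weighted_integral a1 r g `^ r^-1 <= N ->
  weighted_integral a2 r g `^ r^-1 <= N ->
  weighted_integral a q g `^ q^-1 <= (2 `^ (a2 + 3 / r))%R%:E * N.
Proof.
move=> a10 /[dup] /andP[a1a aa2] aa /andP[r0 rq].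
have q0 : (0 < q)%R by exact: lt_le_trans rq.
have a0 : (0 <= a)%R by exact: le_trans a1a.
case: N => [n| |] //; last first.
  by move=> _ _ _; rewrite gt0_muley ?leey// lte_fin powR_gt0.
move=> n0; have W b s := weighted_integral_ge0 b s.
have k0 : 0 <= (2 `^ (a2 + 3 / r))%:E * n%:E by rewrite mule_ge0 ?lee_fin ?powR_ge0.
move=> I1 I2; rewrite (poweRV_le q0 (W a q) k0).
rewrite (poweRV_le r0 (W a1 r) n0) (poweR_EFin n) in I1.
rewrite (poweRV_le r0 (W a2 r) n0) (poweR_EFin n) in I2.
rewrite lee_fin in n0.
have Ir : weighted_integral a r g <= (2 * n `^ r)%:E.
  apply: le_trans (weighted_integral_le_add r0 aa) _.
  rewrite mulr_natl mulr2n EFinD; exact: (leeD I1 I2).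
(* The pointwise bound with exponent r and [Ir] give (t^a g)^r <= 2^(a r + 1) * 2 n^r; the r-th root
   is 2^(a + 2/r) n, and a <= a2. *)
pose M := (2 `^ (a2 + 2 / r) * n)%R.
have M0 : (0 <= M)%R by rewrite mulr_ge0 ?powR_ge0.
have gM t : (0 < t)%R -> (t `^ a)%:E * g t <= M%:E.
  move=> t0; have x0 : 0 <= (t `^ a)%:E * g t.
    by rewrite mule_ge0 ?lee_fin ?powR_ge0.
  rewrite -[leLHS]poweRe1// -(mulfV (lt0r_neq0 r0)) poweRrM poweRV_le ?poweR_ge0//.
  apply: le_trans (weighted_integral_pointwise a0 r0 t0) _.
  apply: (@le_trans _ _ ((2 `^ (a * r + 1))%:E * (2 * n `^ r)%:E)).
    by rewrite lee_wpmul2l// lee_fin powR_ge0.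
  rewrite -EFinM poweR_EFin lee_fin /M powRM ?powR_ge0//.
  rewrite mulrA ler_wpM2r ?powR_ge0//.
  rewrite -powRrM mulrDl divfK ?gt_eqF// -{2}(powRr1 (ler0n R 2)).
  rewrite -powRD ?pnatr_eq0 ?implybT//.
  by apply: ler_powR; rewrite ?ler1n// -addrA lerD// ler_wpM2r// ltW.
apply: le_trans (weighted_integral_bounded (r := r) _ M0 gM) _; first by rewrite r0.
(* Since n <= M, the factor n^r can be replaced by M^r, and the whole bound becomes 2 M^q. *)
apply: (@le_trans _ _ ((M `^ (q - r))%:E * (2 * M `^ r)%:E)).
  rewrite lee_wpmul2l ?lee_fin ?powR_ge0//; apply: le_trans Ir _.
  rewrite lee_fin ler_wpM2l// ge0_ler_powR ?nnegrE ?(ltW r0)//.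
  apply: ler_peMl => //; rewrite -[leLHS](powRr0 2) ler_powR ?ler1n//.
  by rewrite addr_ge0 ?divr_ge0 ?(ltW r0)// (le_trans a0).
rewrite -EFinM -EFinM poweR_EFin lee_fin mulrCA -powRD; last first.
  by rewrite subrK gt_eqF.
(* The q-th root of 2 M^q is 2^(1/q) M <= 2^(1/r) M, which raises 2/r to 3/r and removes the
   dependence on q. *)
rewrite subrK (_ : 2 `^ (a2 + 3 / r) * n = 2 `^ r^-1 * M)%R; last first.
  rewrite /M mulrA -powRD ?pnatr_eq0 ?implybT//; congr (2 `^ _ * n)%R.
  by ring.
rewrite powRM ?powR_ge0// ler_wpM2r ?powR_ge0// -powRrM.
by rewrite -[leLHS](powRr1 (ler0n R 2)) ler_powR ?ler1n// mulrC ler_pdivlMr// mul1r.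
Qed.

(** The integrands converge pointwise, so Fatou bounds the integral by the lower limit of S^(q_n),
    which is S^q; [S] may be infinite. *)
Lemma weighted_integral_root_fatou a q (a_ q_ : R^nat) (S : \bar R) :
  (0 < q)%R -> (forall n, 0 < q_ n)%R ->
  a_ @ \oo --> a -> q_ @ \oo --> q ->
  (forall n, weighted_integral (a_ n) (q_ n) g `^ (q_ n)^-1 <= S) ->
  weighted_integral a q g `^ q^-1 <= S.
Proof.
move=> q0 q_0 aa qq IS.
have S0 : 0 <= S by exact: le_trans (poweR_ge0 _ _) (IS 0%N).
rewrite poweRV_le ?weighted_integral_ge0//.
have ptw t : (0 < t)%R ->
    limn_einf (fun n => weighted_power (a_ n) (q_ n) g t) = weighted_power a q g t.
  move=> t0.
  suff /cvg_limn_einf_sup[] : weighted_power (a_ n) (q_ n) g t @[n --> \oo] -->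
    weighted_power a q g t by [].
  have E b s : weighted_power b s g t =
      (t `^ (b * s))%:E * (g t `^ s) * (t^-1)%:E.
    by rewrite /weighted_power poweRM ?lee_fin ?powR_ge0// poweR_EFin -powRrM.
  rewrite E; under eq_fun do rewrite E.
  have c1 : (t `^ (a_ n * q_ n))%:E @[n --> \oo] --> (t `^ (a * q))%:E.
    apply: cvg_EFin; first exact: nearW.
    rewrite /comp /powR (gt_eqF t0).
    apply: continuous_cvg; first exact: continuous_expR.
    apply: cvgMl; exact: cvgM.
  apply: cvgeZr => //.
  apply: cvgeM => //; last exact: cvg_poweR_exponent.
  (* The factor t^(a q) is a positive real, so the limit is never of the form 0 * oo. *)
  by rewrite mule_defE eqe (gt_eqF (powR_gt0 _ t0))/= andbF.
have -> : weighted_integral a q g =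
    \int[lebesgue_measure]_(t in `]0%R, +oo[)
      limn_einf (fun n => weighted_power (a_ n) (q_ n) g t).
  apply: eq_integral => t; rewrite inE/= in_itv/= andbT => t0.
  by rewrite ptw.
apply: le_trans (fatou _ _ _ _) _ => //.
- by move=> n; exact: measurable_weighted_power.
- by move=> n t /=; rewrite in_itv/= andbT; exact: weighted_power_ge0.
apply: (@le_trans _ _ (limn_einf (fun n => S `^ q_ n))).
  apply: limn_einf_le => n.
  have := IS n.
  by rewrite (poweRV_le (q_0 n) (weighted_integral_ge0 _ _) S0).
by have /cvg_limn_einf_sup[-> _] := @cvg_poweR_exponent _ S _ _ q0 q_0 qq.
Qed.

End weighted_integral.

(** * Decreasing rearrangements and Lorentz norms as weighted integrals *)

Section rearrangement.
Context d (X : measurableType d) (R : realType).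
Variables (mu : {measure set X -> \bar R}) (f : X -> R[i]).

Lemma rearrangement_ge0 t : 0 <= rearrangement mu f t.
Proof.
apply: le_ereal_inf_tmp => _ [s [s0 _] <-]; rewrite lee_fin ltW//.
Qed.

Lemma rearrangement_nonincreasing :
  {homo rearrangement mu f : s t / (s <= t)%R >-> t <= s}.
Proof.
move=> s t st; apply: ereal_inf_le_tmp => _ [u [u0 us] <-].
exists u => //; split => //; apply: le_trans us _; by rewrite lee_fin.
Qed.

End rearrangement.

Lemma lorentz_normE d (X : measurableType d) (R : realType)
    (mu : {measure set X -> \bar R}) (p : \bar R) (q : R) (f : X -> R[i]) :
  lorentz_norm mu p q%:E f =
  weighted_integral (fine p^-1) q (rearrangement mu f) `^ q^-1.
Proof. by []. Qed.

(** For l = oo the reciprocals tend to 0, which is [fine l^-1]; finite and infinite limits of p_n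
    are thus treated alike. *)
Lemma cvg_fine_inve (R : realType) (u : R^nat) (l : \bar R) :
  (forall n, 0 < u n)%R -> 0 < l -> (u n)%:E @[n --> \oo] --> l ->
  (u n)^-1%R @[n --> \oo] --> fine l^-1.
Proof.
move=> u0; case: l => [l| |]// l0 ul.
- have /fine_cvgP[_ {}ul] := ul.
  rewrite inver gt_eqF//=; apply: cvgV => //; rewrite gt_eqF//.
- rewrite invey; apply/gtr0_cvgV0; first exact: nearW.
  exact/cvgeryP.
Qed.

(** * Endpoint norms against the supremum over J and Q *)

Section il_lorentz.
Context d (X : measurableType d) (R : realType).
Variables (mu : {measure set X -> \bar R}) (J Q : set R).
Hypotheses (Jpos : forall p, J p -> (0 < p)%R) (Qpos : forall q, Q q -> (0 < q)%R).

(** Sequences are used because the infimum and supremum of J and the infimum of Q need not be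
    attained. *)
Lemma lorentz_norm_le_il_norm (p_ q_ : R^nat) (p : \bar R) (q : R) (f : X -> R[i]) :
  (forall n, J (p_ n)) -> (forall n, Q (q_ n)) -> 0 < p -> (0 < q)%R ->
  (p_ n)%:E @[n --> \oo] --> p -> q_ @ \oo --> q ->
  lorentz_norm mu p q%:E f <= il_norm mu J Q f.
Proof.
move=> Jp Qq p0 q0 pp qq; rewrite lorentz_normE.
apply: (@weighted_integral_root_fatou _ _ _ _ _ _ (fun n => (p_ n)^-1)%R q_).
- exact: rearrangement_ge0.
- exact: rearrangement_nonincreasing.
- by [].
- by move=> n; exact: Qpos.
- by apply: cvg_fine_inve => // n; exact: Jpos.
- exact: qq.
- move=> n; apply: ereal_sup_ubound.
  exists (p_ n); [exact: Jp|exists (q_ n); first exact: Qq].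
  by rewrite lorentz_normE inver (gt_eqF (Jpos (Jp n))).
Qed.

(** Reciprocals reverse the order: a1 = 1/M, a = 1/p, a2 = 1/m. The constant involves neither p nor
    q, so it survives the supremum over both. *)
Lemma lorentz_norm_interpolation (p q m s : R) (M : \bar R) (f : X -> R[i]) :
  (0 < m <= p)%R -> p%:E <= M -> (0 < s <= q)%R ->
  lorentz_norm mu p%:E q%:E f <=
    (2 `^ (m^-1 + 3 / s))%:E *
    maxe (lorentz_norm mu m%:E s%:E f) (lorentz_norm mu M s%:E f).
Proof.
move=> /andP[m0 mp] pM sq.
have p0 : (0 < p)%R by exact: lt_le_trans mp.
have M0 : 0 < M by apply: lt_le_trans pM; rewrite lte_fin.
have MV : (0 <= fine M^-1 <= p^-1)%R.
  case: M pM M0 => [M| |]// pM M0; last by rewrite invey/= lexx invr_ge0 ltW.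
  rewrite lte_fin in M0; rewrite inver gt_eqF//= invr_ge0 (ltW M0)/=.
  by rewrite lef_pV2 ?posrE// -lee_fin.
have /andP[MV0 MVp] := MV.
have maxl (x y : \bar R) : x <= maxe x y by rewrite le_max lexx.
have maxr (x y : \bar R) : y <= maxe x y by rewrite le_max lexx orbT.
rewrite !lorentz_normE !inver (gt_eqF p0) (gt_eqF m0) /=.
apply: (@weighted_integral_root_le _ _ _ _ _ (fine M^-1) _ _ s).
- exact: rearrangement_ge0.
- exact: rearrangement_nonincreasing.
- exact: MV0.
- by rewrite MVp/= lef_pV2 ?posrE.
- exact: sq.
- exact: le_trans (poweR_ge0 _ _) (maxl _ _).
- exact: maxr.
- exact: maxl.
Qed.

End il_lorentz.

Theorem theorem3p6 (R : realType) (d : measure_display) (X : measurableType d)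
    (mu : {measure set X -> \bar R}) (J Q : set R)
    (J0 : J !=set0) (Q0 : Q !=set0)
    (Jpos : forall p, J p -> (0 < p)%R) (Qpos : forall q, Q q -> (0 < q)%R)
    (infJ : (0 < inf J)%R) (infQ : (0 < inf Q)%R) :
  let mJ : \bar R := (inf J)%:E in
  let mQ : \bar R := (inf Q)%:E in
  let MJ : \bar R := ereal_sup (EFin @` J) in
  il_space mu J Q = lorentz_space mu mJ mQ `&` lorentz_space mu MJ mQ /\
  exists K : R, (0 < K)%R /\
    forall f : {mfun_ mu, X >-> borelC R}, il_space mu J Q f ->
      maxe (lorentz_norm mu mJ mQ f) (lorentz_norm mu MJ mQ f) <=
        il_norm mu J Q f /\
      il_norm mu J Q f <=
        K%:E * maxe (lorentz_norm mu mJ mQ f) (lorentz_norm mu MJ mQ f).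
Proof.
move=> mJ mQ MJ.
have hJ : has_inf J by split=> //; exists 0%R => p /Jpos /ltW.
have hQ : has_inf Q by split=> //; exists 0%R => q /Qpos /ltW.
have Jinf p : J p -> (inf J <= p)%R by exact: (ge_inf hJ.2).
have Qinf q : Q q -> (inf Q <= q)%R by exact: (ge_inf hQ.2).
have JMJ p : J p -> p%:E <= MJ by move=> Jp; apply: ereal_sup_ubound; exists p.
have mJ0 : 0 < mJ by rewrite lte_fin.
have MJ0 : 0 < MJ.
  by case: J0 => p Jp; apply: lt_le_trans (JMJ _ Jp); rewrite lte_fin Jpos.
(* Extremal sequences come as extended reals in the image of [A]; choice pulls them back to real
   sequences in [A]. *)
have seqE (A : set R) (l : \bar R) (u : (\bar R)^nat) :
    (forall n, (EFin @` A) (u n)) -> u @ \oo --> l ->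
    exists v : R^nat, (forall n, A (v n)) /\ (v n)%:E @[n --> \oo] --> l.
  move=> Au ul; have /choice[v vP] n : exists x, A x /\ x%:E = u n.
    by have [x Ax xu] := Au n; exists x.
  exists v; split=> [n|]; first by have [] := vP n.
  by under eq_fun do rewrite (vP _).2.
have imn0 (A : set R) : A !=set0 -> EFin @` A != set0.
  by move=> A0; apply/set0P; exact/image_nonempty.
have seqinf (A : set R) : has_inf A ->
    exists v : R^nat, (forall n, A (v n)) /\ (v n)%:E @[n --> \oo] --> (inf A)%:E.
  move=> [A0 lA]; have [u Au] := ereal_inf_seq (imn0 _ A0).
  by rewrite ereal_inf_EFin//; exact: seqE.
have [pm [Jpm pmJ]] := seqinf _ hJ.
have [qm [Qqm /fine_cvgP[_ qmQ]]] := seqinf _ hQ.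
have [pM [JpM pMJ]] : exists v : R^nat,
    (forall n, J (v n)) /\ (v n)%:E @[n --> \oo] --> MJ.
  by have [u Ju] := ereal_sup_seq (imn0 _ J0); exact: seqE.
pose K : R := (2 `^ ((inf J)^-1 + 3 / inf Q))%R.
(* This bound and [upper] hold for every f, even with infinite norms, so they also give the two
   inclusions between the spaces. *)
have lower (f : X -> R[i]) :
    maxe (lorentz_norm mu mJ mQ f) (lorentz_norm mu MJ mQ f) <= il_norm mu J Q f.
  rewrite ge_max; apply/andP; split.
    exact: (lorentz_norm_le_il_norm mu Jpos Qpos f Jpm Qqm mJ0 infQ pmJ qmQ).
  exact: (lorentz_norm_le_il_norm mu Jpos Qpos f JpM Qqm MJ0 infQ pMJ qmQ).
have upper (f : X -> R[i]) p q : J p -> Q q -> lorentz_norm mu p%:E q%:E f <=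
    K%:E * maxe (lorentz_norm mu mJ mQ f) (lorentz_norm mu MJ mQ f).
  move=> Jp Qq; apply: lorentz_norm_interpolation; last by rewrite infQ Qinf.
  - by rewrite infJ Jinf.
  - exact: JMJ.
have il_upper (f : X -> R[i]) : il_norm mu J Q f <=
    K%:E * maxe (lorentz_norm mu mJ mQ f) (lorentz_norm mu MJ mQ f).
  by apply: ge_ereal_sup => _ [p Jp [q Qq <-]]; exact: upper.
split; last first.
  by exists K; split=> [|f _]; [rewrite powR_gt0|split].
apply/seteqP; split=> f.
  move=> [_ /= flty]; have := le_lt_trans (lower f) flty.
  by rewrite gt_max => /andP[l1 l2]; exact: (conj l1 l2).
move=> [/= f1 f2].
have flty : K%:E * maxe (lorentz_norm mu mJ mQ f) (lorentz_norm mu MJ mQ f) < +oo.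
  apply: lte_mul_pinfty; [by rewrite lee_fin powR_ge0|by []|].
  by rewrite gt_max; apply/andP; exact: (conj f1 f2).
split=> [p Jp q Qq|] /=; last exact: le_lt_trans flty.
by apply: le_lt_trans flty; exact: upper.
Qed.
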